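(* Let $\mathcal H$ be a real Hilbert space and $f:\mathcal H\to\mathbb R\cup\{+\infty\}$ a proper lower semicontinuous convex function that attains its minimum value $f^*>-\infty$. Let $p\ge3$, $\alpha_k=\frac{p}{k+p}$ for $k=0,1,2,\dots$, and let $s,\eta>0$ satisfy $s\ge\frac{\eta}{2}$. Let $\mathbf{x}_0=\mathbf{z}_0\in\mathcal H$ and, for $k\ge0$, $$\mathbf{x}_{k+1}=\mathbf{prox}_{s,f}\big((1-\alpha_k)\mathbf{x}_k+\alpha_k\mathbf{z}_k\big),\qquad \mathbf{z}_{k+1}=\mathbf{z}_k+\frac{\eta}{s\,\alpha_k}\Big(\mathbf{x}_{k+1}-\big((1-\alpha_k)\mathbf{x}_k+\alpha_k\mathbf{z}_k\big)\Big).$$ Then there exists a constant $c$, independent of $k$ (depending on the initialization and the step sizes), such that $$f(\mathbf{x}_k)-f^*\le\frac{c}{k^2}\qquad\text{for all integers }k\ge1.$$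
   Context: For a proper lower semicontinuous convex function $\Psi$ on $\mathcal H$ and $\eta>0$, the Moreau--Yosida proximal operator is $$\mathbf{prox}_{\eta,\Psi}(\mathbf{x})=\arg\min_{\mathbf{y}\in\mathcal H}\Big\{\Psi(\mathbf{y})+\frac{1}{2\eta}\|\mathbf{y}-\mathbf{x}\|^2\Big\}.$$ *)

(* Defs.v *)
From HB Require Import structures.
From mathcomp Require Import all_boot all_order all_algebra.
From mathcomp Require Import all_classical all_reals all_analysis.
Set Implicit Arguments.
Unset Strict Implicit.
Unset Printing Implicit Defensive.
Import Order.TTheory GRing.Theory Num.Theory.
Import numFieldNormedType.Exports.
Local Open Scope classical_set_scope.
Local Open Scope ring_scope.

(* Functions H -> R \cup {+oo} are encoded as functions into \bar R; [eproper]
   is what rules out the value -oo. *)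
Definition eproper (R : realType) (H : Type) (f : H -> \bar R) : Prop :=
  (forall x, (-oo < f x)%E) /\ (exists x, (f x < +oo)%E).

(* The endpoints t = 0, 1 are omitted, so that the product 0 * +oo never
   occurs; the inequality is trivial there. *)
Definition econvex (R : realType) (H : lmodType R) (f : H -> \bar R) : Prop :=
  forall (x y : H) (t : R), 0 < t < 1 ->
    (f (t *: x + (1 - t) *: y)%R <= t%:E * f x + (1 - t)%:E * f y)%E.

Definition argmin (R : realType) (H : Type) (g : H -> \bar R) : set H :=
  [set y | forall z, (g y <= g z)%E].

(* [xget] picks an element of the argmin set. For proper lower semicontinuous
   convex Psi on a Hilbert space and eta > 0 that set is a singleton; the
   default value x is only used if the set is empty. *)
Definition prox (R : realType) (H : normedModType R) (eta : R)
    (Psi : H -> \bar R) (x : H) : H :=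
  xget x (argmin
    (fun y => Psi y + ((2 * eta)^-1 * `|y - x| ^+ 2)%:E)%E).

(* Main.v *)
(* Strong convexity of the prox objective turns minimality of [x_(k+1)] into a
   three-point inequality. Compared with the point
   [(1 - alpha_k) x_k + alpha_k x*], it gives, for [s >= eta / 2],
     [d_(k+1) + alpha_k^2 / (2 eta) (D_(k+1) - D_k) <= (1 - alpha_k) d_k]
   where [d_k = f x_k - f*] and [D_k = |x* - z_k|^2]. Since
   [(1 - alpha_k) / alpha_k^2 <= 1 / alpha_(k-1)^2], the energy
   [d_k / alpha_(k-1)^2 + D_k / (2 eta)] decreases along the iteration. *)
Require Import Defs.
From HB Require Import structures.
From mathcomp Require Import all_boot all_order all_algebra.
From mathcomp Require Import all_classical all_reals all_analysis.
From mathcomp Require Import ring lra.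
Set Implicit Arguments.
Unset Strict Implicit.
Unset Printing Implicit Defensive.
Import Order.TTheory GRing.Theory Num.Theory.
Import numFieldNormedType.Exports.
Local Open Scope classical_set_scope.
Local Open Scope ring_scope.

Lemma affine_combB (R : pzRingType) (V : lmodType R) (t : R) (a b c : V) :
  t *: a + (1 - t) *: b - c = t *: (a - c) + (1 - t) *: (b - c).
Proof. by rewrite !scalerBr addrACA -opprD -scalerDl subrKC scale1r. Qed.

(** The inner product enters the development only through this identity. No bound is put on [t]: it
    is used below with a weight that may exceed 1. *)
Lemma sqnorm_affine_comb (R : realType) (H : normedModType R)
    (ip : {dot H for idfun}) (ip_norm : forall u : H, ip u u = `|u| ^+ 2)
    (t : R) (a b : H) :
  `|t *: a + (1 - t) *: b| ^+ 2 =
    t * `|a| ^+ 2 + (1 - t) * `|b| ^+ 2 - t * (1 - t) * `|a - b| ^+ 2.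
Proof.
have ipC u v : ip u v = ip v u by rewrite hermC expr0 mul1r.
rewrite -!ip_norm !linearDl !linearDr !linearNl !linearNr.
rewrite !linearZl_LR !linearZr_LR /= (ipC b a) /GRing.scale /=; ring.
Qed.

Lemma ereal_real_dense (R : realFieldType) (a : R) (e : \bar R) :
  (a%:E < e)%E -> exists2 b : R, a < b & (b%:E < e)%E.
Proof.
case: e => [r| |] // => [|_]; last by exists (a + 1); rewrite ?ltrDl ?ltry.
rewrite lte_fin => ar; exists ((a + r) / 2); rewrite ?lte_fin; lra.
Qed.

(** A real [b] strictly between [a - g x] and [f x] splits the bound [a]: near [x] both [b < f] and
    [a - b < g] hold. *)
Lemma lower_semicontinuousD_continuous (R : realType) (X : topologicalType)
    (f : X -> \bar R) (g : X -> R) :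
  lower_semicontinuous f -> continuous g ->
  lower_semicontinuous (fun y => f y + (g y)%:E)%E.
Proof.
move=> lf cg x a; rewrite -lteBlDr// -EFinB => /ereal_real_dense[b ab bf].
have [V xV Vf] := lf x b bf.
exists (V `&` [set y | a - b < g y]).
  apply: filterI => //; apply: (cg x [set r | a - b < r]); apply: lt_nbhsr; lra.
move=> y [/Vf bfy /= gy].
rewrite -lteBlDr// -EFinB; apply: lt_trans bfy; rewrite lte_fin; lra.
Qed.

(* Minimizing sequences are Cauchy. *)
Lemma strongly_midconvex_argmin (R : realType) (H : completeNormedModType R)
    (F : H -> \bar R) (m lb : R) :
  0 < m -> lower_semicontinuous F -> (forall y, lb%:E <= F y)%E ->
  (exists y, (F y < +oo)%E) ->
  (forall (a b : H) (u v : R), (F a <= u%:E)%E -> (F b <= v%:E)%E ->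
    (F (2^-1 *: a + (1 - 2^-1) *: b)%R <=
      ((u + v) / 2 - m * `|a - b| ^+ 2)%:E)%E) ->
  argmin F !=set0.
Proof.
move=> m0 lF lbF [y0 Fy0] mid.
(* Real upper bounds of values of [F], rather than the values themselves, so that the infimum is
   taken in [R]. *)
pose S := [set r : R | exists y, (F y <= r%:E)%E].
have lbS : lbound S lb.
  by move=> r [y Fy]; rewrite -lee_fin; exact: le_trans (lbF y) Fy.
have infS : has_inf S.
  split; last by exists lb.
  move: Fy0 (lbF y0); case E : (F y0) => [r| |] // _ _.
  by exists r, y0; rewrite E.
have infS_le y r : (F y <= r%:E)%E -> inf S <= r.
  by move=> Fy; apply: ge_inf; [exact: infS.2|exists y].
have /choice[y Fy] n : exists y, (F y <= (inf S + n.+1%:R^-1)%:E)%E.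
  have n0 : 0 < n.+1%:R^-1 :> R by rewrite invr_gt0.
  have [r [y Fy] rS] := inf_adherent n0 infS; exists y.
  by apply: le_trans Fy _; rewrite lee_fin ltW.
have cy : cauchy (y @ \oo).
  apply: cauchy_exP => e e0.
  have me : 0 < m * e ^+ 2 by rewrite mulr_gt0 // exprn_gt0.
  have [N _ Ne] := near_infty_natSinv_lt (PosNum me).
  exists (y N); exists N => // n /= Nn.
  rewrite -ball_normE /=.
  (* The value of [F] at the midpoint is at least [inf S], so [m |y_N - y_n|^2] is at most the mean
     of [1 / (N + 1)] and [1 / (n + 1)], both below [m e^2]. *)
  have le := infS_le _ _ (mid _ _ _ _ (Fy N) (Fy n)).
  have := Ne n Nn; have := Ne N (leqnn N); rewrite /= => lN ln.
  have d0 : 0 <= `|y N - y n| by [].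
  rewrite -[_ < e]/(`|y N - y n| < e).
  move: `|y N - y n| d0 le => d d0 le.
  rewrite -(@ltr_pXn2r _ 2) ?nnegrE ?(ltW e0)// -(ltr_pM2l m0).
  move: (N.+1%:R^-1) (n.+1%:R^-1) (m * d ^+ 2) (m * e ^+ 2) lN ln le => *; lra.
have /cvg_ex[l yl] : cvg (y @ \oo) by exact: (@cauchy_cvg H).
have Fl : (F l <= (inf S)%:E)%E.
  (* Otherwise lower semicontinuity keeps [F (y n)] above some real [a > inf S] for large [n],
     although [F (y n) <= inf S + 1 / (n + 1)]. *)
  rewrite leNgt; apply/negP => /ereal_real_dense[a Sa aF].
  have [V lV VF] := lF l a aF.
  have Sa0 : 0 < a - inf S by rewrite subr_gt0.
  have [N _ Na] := near_infty_natSinv_lt (PosNum Sa0).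
  have [K _ KV] := yl V lV.
  pose n := maxn N K.
  have aFn : (a%:E < F (y n))%E by apply/VF/KV; exact: leq_maxr.
  have := lt_le_trans aFn (Fy n); rewrite lte_fin.
  have /= := Na n (leq_maxl _ _); move: n.+1%:R^-1 => *; lra.
exists l => z; apply: le_trans Fl _.
case E : (F z) => [r| |]; rewrite ?leey//.
  by rewrite lee_fin; apply: (infS_le z); rewrite E.
by move: (lbF z); rewrite E.
Qed.

(** Real upper bounds stand in for the values of [f], so that later computations take place in
    [R]. *)
Lemma econvex_real (R : realType) (H : lmodType R) (f : H -> \bar R)
    (f_convex : econvex f) (a b : H) (u v t : R) : 0 < t < 1 ->
  (f a <= u%:E)%E -> (f b <= v%:E)%E ->
  (f (t *: a + (1 - t) *: b)%R <= (t * u + (1 - t) * v)%:E)%E.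
Proof.
move=> t01 fa fb; apply: (le_trans (f_convex a b t t01)).
move: t01 => /andP[t0 t1]; rewrite [leRHS]EFinD !EFinM.
by apply: leeD; apply: lee_wpmul2l => //; rewrite lee_fin ?subr_ge0 ltW.
Qed.

(** The quadratic term makes the objective strongly midconvex; hence its argmin set is nonempty and
    [xget] does not fall back on its default. *)
Lemma prox_argmin (R : realType) (H : completeNormedModType R)
    (ip : {dot H for idfun}) (ip_norm : forall u : H, ip u u = `|u| ^+ 2)
    (f : H -> \bar R) (f_proper : eproper f)
    (f_lsc : lower_semicontinuous f) (f_convex : econvex f)
    (lb : R) (f_lb : forall y, (lb%:E <= f y)%E) (s : R) (s_gt0 : 0 < s)
    (y : H) :
  argmin (fun w => f w + ((2 * s)^-1 * `|w - y| ^+ 2)%:E)%E (prox s f y).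
Proof.
have c0 : 0 < (2 * s)^-1 by rewrite invr_gt0 mulr_gt0.
set c := (2 * s)^-1 in c0 *.
rewrite /prox -/c; set F := fun w => _.
have [w Fw] : argmin F !=set0; last exact: (xgetPex _ (ex_intro _ w Fw)).
have q0 w : 0 <= c * `|w - y| ^+ 2.
  by rewrite mulr_ge0 ?exprn_ge0 // ltW.
(* The modulus is [c t (1 - t)] at [t = 1/2]. *)
apply: (@strongly_midconvex_argmin _ _ _ (c / 4) lb); first lra.
- apply: lower_semicontinuousD_continuous => // w.
  apply: cvgM; first exact: cvg_cst.
  by apply: cvgM; apply: cvg_norm; apply: cvgB => //; exact: cvg_cst.
- by move=> w; rewrite -[lb%:E]adde0 leeD // lee_fin.
- by case: f_proper => _ [w fw]; exists w; rewrite lte_add_pinfty ?ltry.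
move=> a b u v; rewrite /F -!leeBrDr // -!EFinB => fa fb.
apply: le_trans (econvex_real f_convex _ fa fb) _; first lra.
rewrite affine_combB (sqnorm_affine_comb ip_norm) opprB addrA subrK.
by rewrite lee_fin; lra.
Qed.

Lemma prox_three_point (R : realType) (H : normedModType R)
    (ip : {dot H for idfun}) (ip_norm : forall u : H, ip u u = `|u| ^+ 2)
    (f : H -> \bar R) (f_proper : eproper f) (f_convex : econvex f)
    (c : R) (c_gt0 : 0 < c) (y w u : H) (fu : R) :
  argmin (fun v => f v + (c * `|v - y| ^+ 2)%:E)%E w -> (f u <= fu%:E)%E ->
  exists2 fw : R, f w = fw%:E &
    fw + c * `|w - y| ^+ 2 + c * `|u - w| ^+ 2 <= fu + c * `|u - y| ^+ 2.
Proof.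
move=> wmin fule.
have := le_trans (wmin u) (leeD2r (c * `|u - y| ^+ 2)%:E fule).
move: (f_proper.1 w) wmin; rewrite /argmin /=.
case Ew : (f w) => [fw| |] // _ wmin _; exists fw => //.
pose A := fw + c * `|w - y| ^+ 2; pose B := fu + c * `|u - y| ^+ 2.
pose Q := c * `|u - w| ^+ 2.
have Q0 : 0 <= Q by rewrite mulr_ge0 ?exprn_ge0 // ltW.
(* Compare with [r u + (1 - r) w]; the claim is the limit [r -> 0]. *)
have key r : 0 < r < 1 -> A <= B - (1 - r) * Q.
  move=> r01; have r0 : 0 < r by case/andP: r01.
  have fw' : (f w <= fw%:E)%E by rewrite Ew.
  have := le_trans (wmin _) (leeD2r _ (econvex_real f_convex r01 fule fw')).
  rewrite -!EFinD lee_fin affine_combB (sqnorm_affine_comb ip_norm).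
  rewrite opprB addrA subrK => le.
  rewrite -(ler_pM2l r0) /A /B /Q; lra.
rewrite -/A -/B -/Q; apply/ler_addgt0Pr => e e0.
(* This weight [r] satisfies [r Q <= e]; the second [e] in the denominator keeps [r < 1] when
   [Q = 0]. *)
have r0 : 0 < e / (e + Q + e) < 1.
  apply/andP; split; first by rewrite divr_gt0 //; lra.
  by rewrite ltr_pdivrMr; lra.
have := key _ r0.
suff : e / (e + Q + e) * Q <= e by lra.
rewrite mulrAC ler_pdivrMr; last lra.
by rewrite ler_pM2l //; lra.
Qed.

(** The bound [b] is left free: it is [fstar] when [alpha = 1], and comes from convexity when
    [alpha < 1]. *)
Lemma accelerated_prox_step (R : realType) (H : normedModType R)
    (ip : {dot H for idfun}) (ip_norm : forall u : H, ip u u = `|u| ^+ 2)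
    (f : H -> \bar R) (f_proper : eproper f) (f_convex : econvex f)
    (s eta alpha : R) (s_gt0 : 0 < s) (eta_gt0 : 0 < eta) (s_ge : eta / 2 <= s)
    (alpha_gt0 : 0 < alpha) (xk zk xstar x' z' : H) (b : R) :
  let y := (1 - alpha) *: xk + alpha *: zk in
  argmin (fun v => f v + ((2 * s)^-1 * `|v - y| ^+ 2)%:E)%E x' ->
  z' = zk + (eta / (s * alpha)) *: (x' - y) ->
  (f ((1 - alpha) *: xk + alpha *: xstar)%R <= b%:E)%E ->
  exists2 a : R, f x' = a%:E &
    a + alpha ^+ 2 / (2 * eta) * (`|xstar - z'| ^+ 2 - `|xstar - zk| ^+ 2) <= b.
Proof.
move=> y xmin zE fu.
have c0 : 0 < (2 * s)^-1 by rewrite invr_gt0 mulr_gt0.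
have [a fa ineq] := prox_three_point ip_norm f_proper f_convex c0 xmin fu.
exists a => //; move: ineq.
(* In terms of [d] and [w], the three differences of the three-point inequality are [alpha] times
   [r w], [d] and [d - r w = r (d - w) + (1 - r) d]. *)
pose r := s / eta; pose d := xstar - zk; pose w := z' - zk.
have xyE : x' - y = (alpha * r) *: w.
  rewrite /w zE [zk + _]addrC addrK scalerA.
  rewrite (_ : alpha * r * _ = 1) ?scale1r // /r; field.
  by rewrite !gt_eqF.
have uyE : (1 - alpha) *: xk + alpha *: xstar - y = alpha *: d.
  by rewrite /y opprD addrACA subrr add0r -scalerBr.
have uxE : (1 - alpha) *: xk + alpha *: xstar - x' =
    alpha *: (r *: (d - w) + (1 - r) *: d).
  rewrite -[_ - x'](subrKA y) uyE -opprB xyE -scalerA -scalerBr.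
  by congr (_ *: _); rewrite (scalerBr r d) scalerBl scale1r [RHS]addrC
    addrA subrK.
have dwE : d - w = xstar - z' by rewrite /d /w opprB addrA subrK.
have nZ t (v : H) : `|t *: v| ^+ 2 = t ^+ 2 * `|v| ^+ 2.
  by rewrite normrZ exprMn real_normK ?num_real.
rewrite uxE uyE xyE !nZ (sqnorm_affine_comb ip_norm) -dwE.
rewrite [d - w - d]addrAC subrr add0r normrN.
set k := alpha ^+ 2 / (2 * s).
have kE : alpha ^+ 2 / (2 * eta) = k * r.
  by rewrite /k /r; field; rewrite !gt_eqF.
have r2 : 1 <= 2 * r by rewrite /r mulrA ler_pdivlMr //; lra.
have k0 : 0 <= k by rewrite /k divr_ge0 ?exprn_ge0 ?mulr_ge0 // ltW.
have W0 : 0 <= k * (r * (2 * r - 1) * `|w| ^+ 2).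
  rewrite mulr_ge0 // mulr_ge0 ?exprn_ge0 // mulr_ge0 ?subr_ge0 //.
  by rewrite divr_ge0 ?ltW.
rewrite kE (mulrC (2 * s)^-1).
move: W0; rewrite /k; lra.
Qed.


Theorem theorem5 (R : realType)
    (* real Hilbert space: complete, with norm induced by an inner product *)
    (H : completeNormedModType R) (ip : {dot H for idfun})
    (ip_norm : forall u : H, ip u u = `|u| ^+ 2)
    (f : H -> \bar R) (f_proper : eproper f)
    (f_lsc : lower_semicontinuous f) (f_convex : econvex f)
    (fstar : R) (f_min : exists2 xstar, argmin f xstar & f xstar = fstar%:E)
    (p : R) (p_ge3 : 3 <= p)
    (alpha : nat -> R) (alphaE : forall k : nat, alpha k = p / (k%:R + p))
    (s eta : R) (s_gt0 : 0 < s) (eta_gt0 : 0 < eta) (s_ge : eta / 2 <= s)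
    (x z : nat -> H) (xz0 : x 0%N = z 0%N)
    (xS : forall k : nat,
      x k.+1 = prox s f ((1 - alpha k) *: x k + alpha k *: z k))
    (zS : forall k : nat,
      z k.+1 = z k + (eta / (s * alpha k)) *:
        (x k.+1 - ((1 - alpha k) *: x k + alpha k *: z k))) :
  exists c : R, forall k : nat, (1 <= k)%N ->
    (f (x k) - fstar%:E <= (c / k%:R ^+ 2)%:E)%E.
Proof.
have [xstar xsmin fxs] := f_min.
have f_lb y : (fstar%:E <= f y)%E by rewrite -fxs; exact: xsmin.
have p_gt0 : 0 < p by lra.
have kp_gt0 k : 0 < k%:R + p by rewrite ltr_wpDl.
have alpha_gt0 k : 0 < alpha k by rewrite alphaE divr_gt0.
pose D k := `|xstar - z k| ^+ 2.
have step k b :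
    (f ((1 - alpha k) *: x k + alpha k *: xstar)%R <= b%:E)%E ->
    exists2 a : R, f (x k.+1) = a%:E &
      a + alpha k ^+ 2 / (2 * eta) * (D k.+1 - D k) <= b.
  apply: (accelerated_prox_step ip_norm f_proper f_convex s_gt0 eta_gt0 s_ge
    (alpha_gt0 k)); last exact: zS.
  by rewrite xS; exact: (prox_argmin ip_norm f_proper f_lsc f_convex f_lb).
pose C := p ^+ 2 / (2 * eta).
have C0 : 0 <= C by rewrite divr_ge0 ?exprn_ge0 ?mulr_ge0 // ltW.
have alphaC k : (k%:R + p) ^+ 2 * (alpha k ^+ 2 / (2 * eta)) = C.
  by rewrite alphaE /C; field; rewrite !gt_eqF.
(* This is the energy multiplied by [p^2], as [p^2 / alpha_k^2 = (k + p)^2]. *)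
have energy k : exists2 a : R, f (x k.+1) = a%:E &
    (k%:R + p) ^+ 2 * (a - fstar) + C * D k.+1 <= C * D 0%N.
  elim: k => [|k [a fa IH]].
    (* Since [alpha 0 = 1], the value [f (x 0)], possibly [+oo], is not used. *)
    have alpha0 : alpha 0%N = 1 by rewrite alphaE add0r divff ?gt_eqF.
    have [|a fa le] := step 0%N fstar.
      by rewrite alpha0 subrr scale0r add0r scale1r fxs.
    exists a => //.
    have := ler_wpM2l (exprn_ge0 2 (ltW (kp_gt0 0%N))) le.
    rewrite mulrDr mulrA alphaC; lra.
  have a_ge : 0 <= a - fstar by rewrite subr_ge0 -lee_fin -fa.
  have alpha01 : 0 < 1 - alpha k.+1 < 1.
    rewrite subr_gt0 ltrBlDr ltrDl alpha_gt0 andbT alphaE.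
    by rewrite ltr_pdivrMr // mul1r ltrDr.
  have [|a' fa' le] :=
      step k.+1 ((1 - alpha k.+1) * a + (1 - (1 - alpha k.+1)) * fstar).
    rewrite -[X in X *: xstar](subKr 1).
    by apply: (econvex_real f_convex alpha01); rewrite ?fa ?fxs.
  exists a' => //.
  have := ler_wpM2l (exprn_ge0 2 (ltW (kp_gt0 k.+1))) le.
  rewrite [leLHS]mulrDr mulrA alphaC => le'.
  have kE : k.+1%:R = k%:R + 1 :> R by rewrite -natr1.
  have kpE : (k.+1%:R + p) ^+ 2 * alpha k.+1 = p * (k.+1%:R + p).
    rewrite alphaE; move: (k.+1%:R + p) (kp_gt0 k.+1) => q q_gt0.
    by field; rewrite gt_eqF.
  (* The first factor is [(k + p)^2 - (1 - alpha_(k+1)) (k + 1 + p)^2], the slack in the comparison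
     of consecutive weights. *)
  have gain : 0 <= ((p - 2) * k%:R + (p ^+ 2 - p - 1)) * (a - fstar).
    apply: mulr_ge0 => //; apply: addr_ge0; last by nra.
    by rewrite mulr_ge0 //; lra.
  have rhsE q : q * ((1 - alpha k.+1) * a + (1 - (1 - alpha k.+1)) * fstar) =
      (q - q * alpha k.+1) * (a - fstar) + q * fstar by ring.
  move: le'; rewrite rhsE kpE kE; lra.
exists (C * D 0%N) => -[//|k] _.
have [a fa le] := energy k.
have a_ge : 0 <= a - fstar by rewrite subr_ge0 -lee_fin -fa.
have CD : 0 <= C * D k.+1 by rewrite mulr_ge0 ?exprn_ge0.
rewrite fa -EFinB lee_fin ler_pdivlMr ?exprn_gt0 // mulrC.
(* The weight at [x_(k+1)] is [(k + p)^2], which dominates [(k + 1)^2] because [p >= 1]. *)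
apply: le_trans (_ : _ <= (k%:R + p) ^+ 2 * (a - fstar)) _; last lra.
apply: ler_wpM2r => //.
rewrite lerXn2r ?nnegrE ?(ltW (kp_gt0 k)) // -natr1; lra.
Qed.
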